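(* There is an absolute constant $C>0$ such that the following holds. Let $A$ be an $m\times n$ integer matrix with $\|A\|_{\gamma_2}\le \gamma$, and let $k=\min\{m,n\}$, where $k\ge 2$. Then $$\operatorname{block}(A)\le 2^{C\gamma^7}(\log k)^2 ,$$ where $\log$ is the natural logarithm.
   Context: A boolean matrix $B\in\{0,1\}^{X\times Y}$ (with $X,Y$ finite index sets) is called blocky if there exist families $\{S_i\}$ of pairwise disjoint subsets of $X$ and $\{T_i\}$ of pairwise disjoint subsets of $Y$ such that the support $\{(x,y): B(x,y)=1\}$ equals $\bigcup_i S_i\times T_i$ (in particular the zero matrix is blocky). The block complexity $\operatorname{block}(A)$ of an integer matrix $A$ is the smallest integer $L\ge 0$ such that $A=\sum_{i=1}^L \sigma_i B_i$ for some blocky matrices $B_i$ of the same shape and signs $\sigma_i\in\{-1,1\}$. The $\gamma_2$ factorization norm of a matrix $A$ is $\|A\|_{\gamma_2}=\min_{UV=A}\|U\|_{\mathrm{row}}\|V\|_{\mathrm{col}}$, where the minimum is over all factorizations $A=UV$ (with an arbitrary inner dimension), $\|U\|_{\mathrm{row}}$ is the largest Euclidean norm of a row of $U$ and $\|V\|_{\mathrm{col}}$ is the largest Euclidean norm of a column of $V$. (By Grothendieck's theorem this equals the Schur multiplier norm of $A$.) *)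

(* Defs.v *)
From HB Require Import structures.
From mathcomp Require Import all_boot all_order all_algebra.
From mathcomp Require Import all_classical all_reals.
From mathcomp Require Import exp.
From mathcomp Require Import Rstruct.
From Stdlib Require Import Rdefinitions.
Set Implicit Arguments. Unset Strict Implicit. Unset Printing Implicit Defensive.
Import Order.TTheory GRing.Theory Num.Theory.
Local Open Scope ring_scope.

Notation RR := Rdefinitions.R.

Definition row_norm (m d : nat) (U : 'M[RR]_(m, d)) : RR :=
  \big[Num.max/0]_(i < m) Num.sqrt (\sum_(j < d) U i j ^+ 2).

Definition col_norm (d n : nat) (V : 'M[RR]_(d, n)) : RR :=
  \big[Num.max/0]_(j < n) Num.sqrt (\sum_(i < d) V i j ^+ 2).

Definition intmx_to_R (m n : nat) (A : 'M[int]_(m, n)) : 'M[RR]_(m, n) :=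
  map_mx (fun z : int => z%:~R) A.

(* gamma_2 factorization norm: min (= inf, attained) over all factorizations
   A = U V with arbitrary inner dimension d of  ||U||_row * ||V||_col. *)
Definition gamma2 (m n : nat) (A : 'M[RR]_(m, n)) : RR :=
  inf [set x : RR | exists (d : nat) (U : 'M[RR]_(m, d)) (V : 'M[RR]_(d, n)),
                      A = U *m V /\ x = row_norm U * col_norm V].

Definition blocky (m n : nat) (B : 'M[bool]_(m, n)) : Prop :=
  exists (L : nat) (S : 'I_L -> {set 'I_m}) (T : 'I_L -> {set 'I_n}),
    (forall l l' : 'I_L, l != l' -> [disjoint S l & S l']) /\
    (forall l l' : 'I_L, l != l' -> [disjoint T l & T l']) /\
    (forall i j, B i j <-> exists l : 'I_L, (i \in S l) /\ (j \in T l)).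

Definition boolmx_to_int (m n : nat) (B : 'M[bool]_(m, n)) : 'M[int]_(m, n) :=
  map_mx (fun b : bool => (b : nat)%:Z) B.

Definition block_decomp (m n : nat) (A : 'M[int]_(m, n)) (L : nat) : Prop :=
  exists (B : 'I_L -> 'M[bool]_(m, n)) (s : 'I_L -> bool),
    (forall l, blocky (B l)) /\
    A = \sum_(l < L) ((-1) ^+ s l) *: boolmx_to_int (B l).

(* block complexity: the least L admitting such a decomposition
   (such an L always exists; the fallback 0 is never used). *)
Definition block (m n : nat) (A : 'M[int]_(m, n)) : nat :=
  match pselect (exists L, `[< block_decomp A L >]) with
  | left h => ex_minn h
  | right _ => 0%N
  end.

(* Main.v *)
Require Import Defs.
From mathcomp Require Import all_boot all_order all_algebra.
From mathcomp Require Import all_classical all_reals.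
From mathcomp Require Import exp.
From mathcomp Require Import Rstruct.
From mathcomp Require Import fintype finset.
From mathcomp Require Import zify ring lra.
Set Implicit Arguments. Unset Strict Implicit. Unset Printing Implicit Defensive.
Import Order.TTheory GRing.Theory Num.Theory.
Local Open Scope ring_scope.

(** Normalise a factorisation to A i j = <u_i, v_j> with |u_i| <= g, |v_j| <= 1.
A perceptron argument shows that any set N of rows has a subset E, of density
2^(-O(g^4)) in N, on which every column of A is constant up to an exceptional
proportion 1/k.  Taking N to be the rows not vanishing on some column, largest
neighbourhoods first, one partitions the nonzero rows into such clusters.  Let C
be the matrix of majority values.  For clusters coming from neighbourhoods of one
dyadic size, every column meets boundedly many of them, so C is a signed sum of
2^(O(g^4)) log m blocky matrices.  The mean w of a cluster pairs with v_j to
nearly the integer C i j, and |w|^2 >= 1/2; hence on a 1/(4 g^2) fraction of the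
rows, passing from (A, u) to (A - C, u - w) lowers |u|^2 by 1/4, at the price of
<u_i, v_j> being equal to the integer entry only up to a small error, which at
most about doubles at each step.  After 4 g^2 steps A has been fully decomposed
on a set of rows of density (4 g^2)^(-4 g^2); log m times the inverse density many
such sets cover all rows, which gives the second logarithm. *)

(** * Blocky matrices and block decompositions *)

Lemma blocky0 m n : blocky (\matrix_(i < m, j < n) false).
Proof.
exists 0%N, (fun=> set0), (fun=> set0); split=> [[]//|]; split=> [[]//|] i j.
by rewrite mxE; split=> // -[[]].
Qed.

Lemma blocky_row_restrict m n (X : {set 'I_m}) (B : 'M[bool]_(m, n)) :
  blocky B -> blocky (\matrix_(i, j) ((i \in X) && B i j)).
Proof.
move=> [L [S [T [dS [dT eB]]]]]; exists L, (fun l => X :&: S l), T; split.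
  move=> l l' /dS; apply: disjointW; first exact: subsetIr.
  exact: subsetIr.
split=> // i j; rewrite mxE; split.
  move=> /andP[iX /eB[l [iS jT]]]; exists l; by rewrite inE iX iS jT.
by move=> [l [/setIP[-> iS] jT]]; apply/eB; exists l.
Qed.

Lemma blocky_trmx m n (B : 'M[bool]_(m, n)) : blocky B -> blocky B^T.
Proof.
move=> [L [S [T [dS [dT eB]]]]]; exists L, T, S; do !split=> //.
  by rewrite mxE => /eB[l []]; exists l.
by rewrite mxE => -[l []] ? ?; apply/eB; exists l.
Qed.

(** Enumerating [P] turns disjoint row sets, each with its own column set, into the indexed families
    of [blocky]; the level sets of cluster matrices are shown blocky this way. *)
Lemma blocky_family m n (P : {set {set 'I_m}}) (T : {set 'I_m} -> {set 'I_n}) :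
  trivIset P ->
  (forall E E', E \in P -> E' \in P -> E != E' -> [disjoint T E & T E']) ->
  blocky (\matrix_(i, j) [exists E in P, (i \in E) && (j \in T E)]).
Proof.
move=> /trivIsetP tP dT.
exists #|P|, (fun l => enum_val l), (fun l => T (enum_val l)); split.
  by move=> l l' ll'; apply: tP; rewrite ?enum_valP ?(inj_eq enum_val_inj).
split.
  by move=> l l' ll'; apply: dT; rewrite ?enum_valP ?(inj_eq enum_val_inj).
move=> i j; rewrite mxE; split.
  move=> /exists_inP[E EP /andP[iE jT]]; exists (enum_rank_in EP E).
  by rewrite enum_rankK_in.
move=> [l [iS jT]]; apply/exists_inP; exists (enum_val l); rewrite ?enum_valP //.
by rewrite iS.
Qed.

Lemma block_le m n (A : 'M[int]_(m, n)) L :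
  block_decomp A L -> (block A <= L)%N.
Proof.
move=> dA; rewrite /block; case: pselect => [h|//].
by case: ex_minnP => k _; apply; apply/asboolP.
Qed.

Lemma block_decomp1 m n (B : 'M[bool]_(m, n)) (s : bool) : blocky B ->
  block_decomp ((-1) ^+ s *: boolmx_to_int B) 1.
Proof. by move=> bB; exists (fun=> B), (fun=> s); rewrite big_ord1. Qed.

Lemma block_decomp0 m n L : block_decomp (0 : 'M[int]_(m, n)) L.
Proof.
exists (fun=> \matrix_(i < m, j < n) false), (fun=> false).
split=> [l|]; first exact: blocky0.
rewrite big1 // => l _; apply/matrixP => i j.
by rewrite !mxE mulr0.
Qed.

Lemma block_decompD m n (A1 A2 : 'M[int]_(m, n)) L1 L2 :
  block_decomp A1 L1 -> block_decomp A2 L2 -> block_decomp (A1 + A2) (L1 + L2).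
Proof.
move=> [B1 [s1 [b1 ->]]] [B2 [s2 [b2 ->]]].
exists (fun l => match split l with inl i => B1 i | inr i => B2 i end).
exists (fun l => match split l with inl i => s1 i | inr i => s2 i end).
split=> [l|]; first by case: split.
rewrite big_split_ord /=; congr (_ + _); apply: eq_bigr => i _.
  by rewrite (unsplitK (inl i)).
by rewrite (unsplitK (inr i)).
Qed.

Lemma block_decomp_leq m n (A : 'M[int]_(m, n)) L L' :
  (L <= L')%N -> block_decomp A L -> block_decomp A L'.
Proof.
move=> /subnKC<- dA; rewrite -[A]addr0; apply: block_decompD => //.
exact: block_decomp0.
Qed.

Lemma block_decomp_sum m n t (A : 'I_t -> 'M[int]_(m, n)) L :
  (forall i, block_decomp (A i) L) -> block_decomp (\sum_(i < t) A i) (t * L).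
Proof.
elim: t A => [|t IH] A dA; first by rewrite big_ord0; exact: block_decomp0.
rewrite big_ord_recl mulSn; apply: block_decompD => //.
by apply: IH.
Qed.

(** Rows outside [X] are zeroed rather than deleted: the shape is kept, and restrictions to disjoint
    row sets can be added. *)
Definition row_restrict m n (X : {set 'I_m}) (A : 'M[int]_(m, n)) :
  'M[int]_(m, n) := \matrix_(i, j) if i \in X then A i j else 0.

Lemma block_decomp_row_restrict m n (X : {set 'I_m}) (A : 'M[int]_(m, n)) L :
  block_decomp A L -> block_decomp (row_restrict X A) L.
Proof.
move=> [B [s [bB ->]]].
exists (fun l => \matrix_(i, j) ((i \in X) && B l i j)), s.
split=> [l|]; first exact: blocky_row_restrict.
apply/matrixP => i j; rewrite mxE !summxE; case: ifP => iX.
  by apply: eq_bigr => l _; rewrite !mxE iX.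
by rewrite big1 // => l _; rewrite !mxE iX mulr0.
Qed.

Lemma block_decomp_trmx m n (A : 'M[int]_(m, n)) L :
  block_decomp A L -> block_decomp A^T L.
Proof.
move=> [B [s [bB ->]]]; exists (fun l => (B l)^T), s.
split=> [l|]; first exact: blocky_trmx.
apply/matrixP => i j; rewrite mxE !summxE; apply: eq_bigr => l _.
by rewrite !mxE.
Qed.

(** For a disjoint family [P] the sum has at most one term; as a sum it is 0 on the rows outside all
    clusters. *)
Definition cluster_mx m n (P : {set {set 'I_m}}) (c : {set 'I_m} -> 'I_n -> int) :
  'M[int]_(m, n) := \matrix_(i, j) \sum_(E in P | i \in E) c E j.

Lemma cluster_mxE m n (P : {set {set 'I_m}}) (c : {set 'I_m} -> 'I_n -> int)
    E i j : trivIset P -> E \in P -> i \in E ->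
  cluster_mx P c i j = c E j.
Proof.
move=> tP EP iE; rewrite mxE (big_pred1 E) // => F /=.
apply/andP/eqP => [[FP iF]|->//].
by rewrite -(def_pblock tP FP iF) (def_pblock tP EP iE).
Qed.

Lemma cluster_mx_out m n (P : {set {set 'I_m}}) (c : {set 'I_m} -> 'I_n -> int)
    i j : i \notin cover P -> cluster_mx P c i j = 0.
Proof.
move=> iP; rewrite mxE big1 // => E /andP[EP iE]; case/negP: iP.
by apply/bigcupP; exists E.
Qed.

(** Layer-cake formula: exactly [|z|] of the thresholds are passed, all on the side given by the
    sign of [z]. Entrywise, it splits a matrix bounded by [g] into [2g] signed boolean matrices. *)
Lemma int_layers (z : int) (g : nat) : (`|z| <= g)%N ->
  z = \sum_(a < g) (((a%:Z < z)%R : nat)%:Z - ((z < - a%:Z)%R : nat)%:Z).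
Proof.
elim: g z => [|g IH] z zg; first by rewrite big_ord0; lia.
rewrite big_ord_recr /=.
have [zg'|zg'] := leqP `|z| g.
  rewrite -IH //.
  have -> : ((g : int) < z)%R = false by lia.
  have -> : (z < - (g : int))%R = false by lia.
  by rewrite subrr addr0.
have [z0|z0] := leP 0 z.
  have -> : ((g : int) < z)%R by lia.
  have -> : (z < - (g : int))%R = false by lia.
  rewrite (eq_bigr (fun=> 1)); last first.
    move=> [a ag] _ /=.
    have -> : ((a : int) < z)%R by lia.
    by have -> : (z < - (a : int))%R = false by lia.
  by rewrite sumr_const card_ord; lia.
have -> : ((g : int) < z)%R = false by lia.
have -> : (z < - (g : int))%R by lia.
rewrite (eq_bigr (fun=> -1)); last first.
  move=> [a ag] _ /=.
  have -> : ((a : int) < z)%R = false by lia.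
  by have -> : (z < - (a : int))%R by lia.
by rewrite sumr_const card_ord; lia.
Qed.

(* The j-th layer keeps, in each column, only the j-th cluster meeting it; its
   columns then meet at most one cluster, so each level set is blocky. *)
Lemma block_decomp_cluster m n (P : {set {set 'I_m}})
    (c : {set 'I_m} -> 'I_n -> int) (r g : nat) :
  trivIset P ->
  (forall E j, E \in P -> (`|c E j| <= g)%N) ->
  (forall j, #|[set E in P | c E j != 0]| <= r)%N ->
  block_decomp (cluster_mx P c) (r * (g * 2)).
Proof.
move=> tP cg cr.
pose J j := enum [set E in P | c E j != 0].
pose lev (Q : pred int) (t : nat) : 'M[bool]_(m, n) := \matrix_(i, j)
  [exists E in P, (i \in E) &&
     (j \in [set j | [&& E \in J j, index E (J j) == t & Q (c E j)]])].
have lev_blocky Q t : blocky (lev Q t).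
  apply: (blocky_family
    (T := fun E => [set j | [&& E \in J j, index E (J j) == t & Q (c E j)]])) => //.
  (* A common column would list both clusters at the same position [t] of [J j], so they would be
     equal. *)
  move=> E E' EP E'P; apply: contraR => /pred0Pn[j] /=; rewrite !inE.
  move=> /andP[/and3P[EJ /eqP iE _] /and3P[E'J /eqP iE' _]].
  by rewrite -(nth_index E EJ) -(nth_index E E'J) iE iE'.
have -> : cluster_mx P c = \sum_(t < r) \sum_(a < g)
   ((-1) ^+ false *: boolmx_to_int (lev (fun z => a%:Z < z) t)
   + (-1) ^+ true *: boolmx_to_int (lev (fun z => z < - a%:Z) t)).
  apply/matrixP => i j; rewrite summxE.
  under eq_bigr => t _ do rewrite summxE.
  under eq_bigr => t _ do under eq_bigr => a _ do rewrite !mxE mul1r mulN1r.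
  have [iP|iP] := boolP (i \in cover P); last first.
    rewrite cluster_mx_out // big1 // => t _; rewrite big1 // => a _.
    have none (T : {set 'I_m} -> {set 'I_n}) : [exists E in P, (i \in E) && (j \in T E)] = false.
      apply/exists_inP => -[E EP /andP[iE _]]; case/negP: iP.
      by apply/bigcupP; exists E.
    by rewrite !none.
  have /bigcupP[E EP iE] := iP.
  rewrite (cluster_mxE _ _ tP EP iE).
  have one (T : {set 'I_m} -> {set 'I_n}) :
      [exists E in P, (i \in E) && (j \in T E)] = (j \in T E).
    apply/exists_inP/idP => [[F FP /andP[iF]]|jT]; last by exists E; rewrite ?iE.
    by rewrite -(def_pblock tP FP iF) (def_pblock tP EP iE).
  under eq_bigr => t _ do under eq_bigr => a _ do rewrite !one !inE.
  have [c0|c0] := eqVneq (c E j) 0.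
    rewrite c0 big1 // => t _; rewrite big1 // => a _.
    by rewrite [(_ < 0)%R]ltNge [(0 < _)%R]ltNge !oppr_le0 !lez_nat !leq0n /= !andbF.
  have EJ : E \in J j by rewrite mem_enum inE EP.
  have lt_r : (index E (J j) < r)%N.
    by apply: leq_trans (cr j); rewrite cardE index_mem.
  (* Only the layer at the position of [E] in [J j] contributes to this entry. *)
  rewrite (bigD1 (Ordinal lt_r)) //= [X in _ + X]big1 ?addr0 => [|t].
    by rewrite EJ eqxx /=; apply: int_layers; exact: cg.
  rewrite -val_eqE /= eq_sym => /negPf ti; rewrite big1 // => a _.
  by rewrite ti !andbF.
apply: block_decomp_sum => t; apply: block_decomp_sum => a.
by apply: (@block_decompD _ _ _ _ 1 1); apply: block_decomp1.
Qed.

(** * Almost constant sets of rows *)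

Section Dot.
Variables (R : realFieldType) (d : nat).
Implicit Types u v w : 'rV[R]_d.

Definition dot u v : R := \sum_k u 0 k * v 0 k.

Lemma dotC u v : dot u v = dot v u.
Proof. by apply: eq_bigr => k _; rewrite mulrC. Qed.

Lemma dotDl u v w : dot (u + v) w = dot u w + dot v w.
Proof. by rewrite -big_split; apply: eq_bigr => k _; rewrite mxE mulrDl. Qed.

Lemma dotZl a u w : dot (a *: u) w = a * dot u w.
Proof. by rewrite mulr_sumr; apply: eq_bigr => k _; rewrite mxE mulrA. Qed.

Lemma dotBl u v w : dot (u - v) w = dot u w - dot v w.
Proof. by rewrite -scaleN1r dotDl dotZl mulN1r. Qed.

Lemma dotDr u v w : dot u (v + w) = dot u v + dot u w.
Proof. by rewrite dotC dotDl !(dotC _ u). Qed.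

Lemma dotBr u v w : dot u (v - w) = dot u v - dot u w.
Proof. by rewrite dotC dotBl !(dotC _ u). Qed.

Lemma dot0l w : dot 0 w = 0.
Proof. by rewrite -(scale0r 0) dotZl mul0r. Qed.

Lemma dot_suml (I : finType) (P : pred I) (F : I -> 'rV[R]_d) w :
  dot (\sum_(i | P i) F i) w = \sum_(i | P i) dot (F i) w.
Proof.
by apply: (big_morph (dot^~ w)) => [u v|]; rewrite ?dotDl ?dot0l.
Qed.

Lemma dot_ge0 u : 0 <= dot u u.
Proof. by apply: sumr_ge0 => k _; rewrite -expr2 sqr_ge0. Qed.

Lemma dot_CauchySchwarz u v : dot u v ^+ 2 <= dot u u * dot v v.
Proof.
have quad t : 0 <= dot u u - 2 * t * dot u v + t ^+ 2 * dot v v.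
  have := dot_ge0 (u - t *: v); rewrite dotBl !dotBr !dotZl !(dotC _ (t *: v)) !dotZl.
  by rewrite (dotC v u); lra.
have [v0|v_neq0] := eqVneq (dot v v) 0.
  have [->|uv] := eqVneq (dot u v) 0; first by rewrite v0 mulr0 expr0n.
  (* With [dot v v = 0] the quadratic is affine in [t], and this [t] makes it equal to -1. *)
  have := quad ((dot u u + 1) / (2 * dot u v)); rewrite v0 mulr0 addr0.
  have -> : 2 * ((dot u u + 1) / (2 * dot u v)) * dot u v = dot u u + 1 by field.
  by move=> ?; exfalso; lra.
have v_gt0 : 0 < dot v v by rewrite lt_def v_neq0 dot_ge0.
have := quad (dot u v / dot v v).
have -> : dot u u - 2 * (dot u v / dot v v) * dot u v
   + (dot u v / dot v v) ^+ 2 * dot v v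
   = (dot u u * dot v v - dot u v ^+ 2) / dot v v by field.
by rewrite pmulr_lge0 ?invr_gt0 // subr_ge0.
Qed.

End Dot.

(** The exceptional proportion is at most [1/k], multiplied out to stay in the naturals; the value
    [c] may depend on the column. *)
Definition almost_const m n (k : nat) (A : 'M[int]_(m, n)) (E : {set 'I_m}) :=
  forall j, exists c, (k * #|[set i in E | A i j != c]| <= #|E|)%N.

(** Take the least [c] with at least a [1/(2k)] proportion of the values at or below it. Fewer than
    that lie strictly below [c], while more than [1/k] differ from [c], so at least [1/(2k)] lie
    above. Both sides are inhabited, which bounds [c] and [c + 1]. *)
Lemma balanced_threshold m (k g : nat) (E : {set 'I_m}) (a : 'I_m -> int) :
  (forall i, i \in E -> (`|a i| <= g)%N) ->
  (forall c, #|E| < k * #|[set i in E | a i != c]|)%N ->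
  exists c : int, [/\ (`|c| <= g)%N, (`|(c + 1)%R| <= g)%N,
    (#|E| <= 2 * k * #|[set i in E | (a i <= c)%R]|)%N
    & (#|E| <= 2 * k * #|[set i in E | (c < a i)%R]|)%N].
Proof.
move=> ag unb.
have k0 : (0 < k)%N by move: (unb 0); case: k {unb}.
(* Shifting by [g] turns the search for the least threshold into a minimum over the naturals. *)
have ex : exists t, (#|E| <= 2 * k * #|[set i in E | (a i <= t%:Z - g%:Z)%R]|)%N.
  exists (2 * g)%N.
  have -> : [set i in E | (a i <= (2 * g)%N%:Z - g%:Z)%R] = E.
    apply/setP => i; rewrite inE; case: (boolP (i \in E)) => //= iE.
    by have := ag i iE; lia.
  by rewrite leq_pmull // muln_gt0.
case: (ex_minnP ex) => t lbt mint.
pose c := t%:Z - g%:Z.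
have low : (2 * k * #|[set i in E | (a i < c)%R]| < #|E|)%N.
  case: t => [|t] in lbt mint c *.
    have -> : [set i in E | (a i < c)%R] = set0.
      apply/setP => i; rewrite !inE; apply/negP => /andP[/ag].
      by rewrite /c; lia.
    rewrite cards0 muln0 lt0n; apply/negP => /eqP E0.
    have := unb 0; rewrite E0 (_ : #|_| = 0)%N ?muln0 //.
    apply/eqP; rewrite -leqn0 -[leqRHS]E0; apply: subset_leq_card.
    by apply/subsetP => i; rewrite inE => /andP[].
  rewrite ltnNge; apply/negP => h.
  suff : (t.+1 <= t)%N by rewrite ltnn.
  apply: mint; apply: leq_trans h _; rewrite leq_mul2l; apply/orP; right.
  apply: subset_leq_card; apply/subsetP => i; rewrite !inE => /andP[-> /=].
  by rewrite /c; lia.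
have neq : (#|[set i in E | a i != c]| <=
   #|[set i in E | (a i < c)%R]| + #|[set i in E | (c < a i)%R]|)%N.
  apply: leq_trans (leq_card_setU _ _); apply: subset_leq_card.
  by apply/subsetP => i; rewrite !inE neq_lt -andb_orr.
have high : (#|E| <= 2 * k * #|[set i in E | (c < a i)%R]|)%N.
  by have := unb c; have := leq_mul (leqnn k) neq; rewrite mulnDr; lia.
exists c.
have nonempty (p : pred 'I_m) : (#|E| <= 2 * k * #|[set i in E | p i]|)%N ->
    exists2 i, i \in E & p i.
  move=> h; case: (set_0Vmem [set i in E | p i]) => [e0|[i]].
    by move: h low; rewrite e0 cards0 muln0; lia.
  by rewrite inE => /andP[]; exists i.
have [i iE ci] := nonempty _ high; have [i' i'E ci'] := nonempty _ lbt.
by have := ag i iE; have := ag i' i'E; rewrite -/c in ci'; split=> //; lia.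
Qed.

Section AlmostConstant.
Variables (R : realFieldType) (d m n : nat).
Variables (u : 'I_m -> 'rV[R]_d) (v : 'I_n -> 'rV[R]_d) (A : 'M[int]_(m, n)).
Variables (g k : nat).
Hypothesis v_le1 : forall j, dot (v j) (v j) <= 1.

(** Cauchy-Schwarz bounds the inner product by [g], and an integer within 1/4 of it cannot exceed
    [g] in absolute value. *)
Lemma approx_entry_le (e : R) i j :
  e <= 1 / 4 -> dot (u i) (u i) <= g%:R ^+ 2 -> `|dot (u i) (v j) - (A i j)%:~R| <= e ->
  (`|A i j| <= g)%N.
Proof.
move=> e4 ug uvA.
have : dot (u i) (v j) ^+ 2 <= g%:R ^+ 2.
  apply: le_trans (dot_CauchySchwarz _ _) _.
  by rewrite -[leRHS]mulr1; apply: ler_pM => //; exact: dot_ge0.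
rewrite -real_normK ?num_real // ler_sqr ?nnegrE // => uv_g.
have : `|(A i j)%:~R| < (g.+1)%:R :> R.
  have := ler_normB (dot (u i) (v j)) (dot (u i) (v j) - (A i j)%:~R).
  rewrite subKr -natr1; lra.
by rewrite -intr_norm -mulrz_nat ltr_int; lia.
Qed.

Hypotheses (g_gt0 : (0 < g)%N) (k_gt0 : (0 < k)%N).

(* Perceptron: while the current set is not almost constant on some column,
   split it at a balanced threshold and keep the side on which the running
   hypothesis (h, r) errs.  Each mistake raises the margin by 1/4 but the squared
   norm of the hypothesis by at most 2, so there are O(g^2) mistakes. *)
Lemma almost_const_subset (N : {set 'I_m}) :
  (0 < #|N|)%N ->
  (forall i, i \in N -> dot (u i) (u i) <= g%:R ^+ 2) ->
  (forall i j, i \in N -> `|dot (u i) (v j) - (A i j)%:~R| <= 1 / 4) ->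
  exists E : {set 'I_m}, [/\ E \subset N, almost_const k A E
    & (#|N| <= (2 * k) ^ (64 * g ^ 2 + 1) * #|E|)%N].
Proof.
move=> N_gt0 ug uvA.
have g0 : 0 < g%:R :> R by rewrite ltr0n.
(* Either a suitable set has been found, or [t] mistakes have been made; [r] is the coordinate of
   the hypothesis along an extra constant coordinate [g] of each [u i]. *)
have main t : (exists E : {set 'I_m}, [/\ E \subset N, almost_const k A E
                  & (#|N| <= (2 * k) ^ t * #|E|)%N]) \/
    (exists (E : {set 'I_m}) h r, [/\ E \subset N, (#|N| <= (2 * k) ^ t * #|E|)%N,
      (forall i, i \in E -> t%:R / 4 <= dot (u i) h + g%:R * r)
      & dot h h + r ^+ 2 <= 2 * t%:R]).
  elim: t => [|t [[E [EN Ec NE]]|[E [h [r [EN NE marg nrm]]]]]].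
  - right; exists N, 0, 0; split; rewrite ?expn0 ?mul1n //.
      by move=> i _; rewrite dotC dot0l; lra.
    by rewrite dot0l; lra.
  - left; exists E; split=> //; apply: leq_trans NE _.
    by rewrite leq_mul2r leq_exp2l ?leqnSn ?orbT //; lia.
  have [Ec|/existsNP[j /forallNP Ec]] := pselect (almost_const k A E).
    left; exists E; split=> //; apply: leq_trans NE _.
    by rewrite leq_mul2r leq_exp2l ?leqnSn ?orbT //; lia.
  right.
  have [||c [cg c1g low high]] := @balanced_threshold _ k g E (fun i => A i j).
  - move=> i /(subsetP EN) iN.
    by apply: (@approx_entry_le (1/4)); [exact: lexx | exact: ug | exact: uvA].
  - by move=> c; rewrite ltnNge; apply/negP/Ec.
  (* A half-integer threshold stays at distance at least 1/4 from every inner product, these being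
     within 1/4 of integers. *)
  pose th : R := c%:~R + 1 / 2.
  have th_le : (th / g%:R) ^+ 2 <= 1.
    rewrite expr_div_n ler_pdivrMr ?exprn_gt0 // mul1r.
    have : - g%:R <= c%:~R :> R by rewrite -mulrz_nat -mulrNz ler_int; lia.
    have : c%:~R + 1 <= g%:R :> R.
      by rewrite -[1 : R](mulr1z) -mulrzDr -[g%:R]mulrz_nat ler_int; lia.
    by rewrite /th; nra.
  (* The sign of [p] selects the side to keep: the update then has a cross term that does not
     increase the squared norm, and the two new squares are at most 1 each. *)
  pose p := dot h (v j) - r * (th / g%:R).
  have [p0|p0] := leP 0 p.
    exists [set i in E | A i j <= c], (h - v j), (r + th / g%:R); split.
    + by apply: subset_trans EN; apply/subsetP => i; rewrite inE => /andP[].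
    + apply: leq_trans NE _; rewrite expnSr -mulnA leq_mul2l; apply/orP; right.
      exact: low.
    + move=> i; rewrite inE => /andP[iE Ac].
      have := marg i iE; have := uvA i j (subsetP EN i iE); rewrite ler_norml.
      have : (A i j)%:~R <= c%:~R :> R by rewrite ler_int.
      have gth : g%:R * (th / g%:R) = th by rewrite mulrCA divff ?mulr1 ?gt_eqF.
      by rewrite dotBr mulrDr gth /th -[t.+1%:R]natr1 => ? /andP[_ ?] ?; lra.
    + rewrite dotBl !dotBr (dotC (v j) h).
      have := v_le1 j; move: p0 th_le nrm; rewrite /p -[t.+1%:R]natr1.
      by move: (th / g%:R) => q; lra.
  exists [set i in E | (c < A i j)%R], (h + v j), (r - th / g%:R); split.
  + by apply: subset_trans EN; apply/subsetP => i; rewrite inE => /andP[].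
  + apply: leq_trans NE _; rewrite expnSr -mulnA leq_mul2l; apply/orP; right.
    exact: high.
  + move=> i; rewrite inE => /andP[iE Ac].
    have := marg i iE; have := uvA i j (subsetP EN i iE); rewrite ler_norml.
    have : c%:~R + 1 <= (A i j)%:~R :> R.
      by rewrite -[1 : R](mulr1z) -mulrzDr ler_int; lia.
    have gth : g%:R * (th / g%:R) = th by rewrite mulrCA divff ?mulr1 ?gt_eqF.
    by rewrite dotDr mulrBr gth /th -[t.+1%:R]natr1 => ? /andP[? _] ?; lra.
  + rewrite dotDl !dotDr (dotC (v j) h).
    have := v_le1 j; move: p0 th_le nrm; rewrite /p -[t.+1%:R]natr1.
      by move: (th / g%:R) => q; lra.
(* Cauchy-Schwarz gives [(t/4)^2 <= 4 g^2 t], that is [t <= 64 g^2], so one more mistake is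
   impossible. *)
have [//|[E [h [r [EN NE marg nrm]]]]] := main (64 * g ^ 2 + 1)%N.
have : (0 < #|E|)%N by move: NE; rewrite lt0n; case: eqP => [->|//]; rewrite muln0; lia.
case/card_gt0P => i iE; have iN := subsetP EN i iE.
have := marg i iE; have := dot_CauchySchwarz (u i) h; have := ug i iN.
move: nrm; set t : R := (64 * g ^ 2 + 1)%:R.
have -> : t = 64 * g%:R ^+ 2 + 1 by rewrite /t natrD natrM natrX.
have := dot_ge0 (u i); have := dot_ge0 h.
move: (dot h h) (dot (u i) (u i)) (dot (u i) h) (g%:R : R) g0 => H U X G G0 H0 U0 nrm UG CS marg'.
have : X ^+ 2 <= G ^+ 2 * H by apply: le_trans CS _; rewrite ler_wpM2r.
have sq : (X + G * r) ^+ 2 <= 2 * (X ^+ 2 + G ^+ 2 * r ^+ 2).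
  by rewrite -subr_ge0 (_ : _ - _ = (X - G * r) ^+ 2) ?sqr_ge0 //; ring.
have : G ^+ 2 * (H + r ^+ 2) <= G ^+ 2 * (2 * (64 * G ^+ 2 + 1)).
  by rewrite ler_wpM2l // sqr_ge0.
have : ((64 * G ^+ 2 + 1) / 4) ^+ 2 <= (X + G * r) ^+ 2.
  rewrite ler_sqr ?nnegrE //; last by apply: le_trans marg'; nra.
  nra.
by have := sqr_ge0 G; nra.
Qed.

End AlmostConstant.

(** * Removing the clusters lowers the norm *)

Definition mean (R : realFieldType) d m (u : 'I_m -> 'rV[R]_d) (E : {set 'I_m}) :=
  #|E|%:R^-1 *: \sum_(i in E) u i.

Definition nbr m n (A : 'M[int]_(m, n)) (U : {set 'I_m}) j :=
  [set i in U | A i j != 0].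

(* Rows on which the matrix already vanishes are exempt from the vector bounds. *)
Definition row_ok (R : realFieldType) d m n (v : 'I_n -> 'rV[R]_d) (rho e : R)
    (u : 'I_m -> 'rV[R]_d) (A : 'M[int]_(m, n)) i :=
  (forall j, A i j = 0) \/
  (dot (u i) (u i) <= rho /\ forall j, `|dot (u i) (v j) - (A i j)%:~R| <= e).

(** The variance identity: the vectors of [E] sum to [#|E|] times their mean, which evaluates the
    cross terms. *)
Lemma sum_sqr_dist_mean (R : realFieldType) d m (u : 'I_m -> 'rV[R]_d)
    (E : {set 'I_m}) : (0 < #|E|)%N ->
  \sum_(i in E) dot (u i - mean u E) (u i - mean u E) =
  \sum_(i in E) dot (u i) (u i) - #|E|%:R * dot (mean u E) (mean u E).
Proof.
move=> E0; set w := mean u E.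
have sumw : \sum_(i in E) dot (u i) w = #|E|%:R * dot w w.
  rewrite -dot_suml -dotZl /w /mean scalerA divff ?scale1r //.
  by rewrite pnatr_eq0 -lt0n.
under eq_bigr => i _ do rewrite dotBl !dotBr (dotC w (u i)).
rewrite !sumrB sumw sumr_const -mulr_natl; ring.
Qed.

(** A Markov argument: the squared distances to the mean average at most [rho - 1/2], so those above
    [rho - 1/4] cannot take up almost all of [E]. *)
Lemma card_near_mean (R : realFieldType) d m (u : 'I_m -> 'rV[R]_d)
    (E : {set 'I_m}) (g : nat) (rho : R) : (0 < #|E|)%N ->
  (forall i, i \in E -> dot (u i) (u i) <= rho) -> rho <= g%:R ^+ 2 ->
  1 / 2 <= dot (mean u E) (mean u E) ->
  (#|E| <= 4 * g ^ 2 *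
     #|[set i in E | (dot (u i - mean u E) (u i - mean u E) <= rho - 1 / 4)%R]|)%N.
Proof.
move=> E0 ub rg w_ge; have := sum_sqr_dist_mean u E0.
set w := mean u E; set X := [set i in E | _].
pose Y := [set i in E | (rho - 1 / 4 < dot (u i - w) (u i - w))%R].
have EXY : #|E| = (#|X| + #|Y|)%N.
  rewrite -(cardsID X E); congr (_ + _)%N; apply: eq_card => i; rewrite !inE.
    by case: (i \in E).
  by rewrite ltNge; case: (i \in E); rewrite ?andbT ?andbF.
have up : \sum_(i in E) dot (u i) (u i) <= #|E|%:R * rho.
  rewrite mulr_natl -sumr_const; apply: ler_sum => i iE; exact: ub.
have low : #|Y|%:R * (rho - 1 / 4) <= \sum_(i in E) dot (u i - w) (u i - w).
  rewrite mulr_natl -sumr_const [leRHS](big_setID Y) /= ler_wpDr //.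
    by apply: sumr_ge0 => i _; exact: dot_ge0.
  rewrite (setIidPr _); last by apply/subsetP => i; rewrite inE => /andP[].
  by apply: ler_sum => i; rewrite inE => /andP[_ /ltW].
move=> sumE; rewrite -(ler_nat R) !natrM.
have wE : #|E|%:R * (1 / 2) <= #|E|%:R * dot w w by rewrite ler_wpM2l.
have XR : #|E|%:R = #|X|%:R + #|Y|%:R :> R by rewrite -natrD EXY.
have XX : #|X|%:R * rho <= #|X|%:R * g%:R ^+ 2 by rewrite ler_wpM2l.
have : #|X|%:R * (rho - 1 / 4) <= #|X|%:R * rho.
  by rewrite ler_wpM2l //; lra.
move: low up sumE wE XX; rewrite XR.
move: (#|X|%:R : R) (#|Y|%:R : R) => x y; lra.
Qed.

Lemma entryD (V : zmodType) m n (A B : 'M[V]_(m, n)) i j :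
  (A + B) i j = A i j + B i j.
Proof. by rewrite mxE. Qed.

Lemma entryB (V : zmodType) m n (A B : 'M[V]_(m, n)) i j :
  (A - B) i j = A i j - B i j.
Proof. by rewrite !mxE. Qed.

(** * One round: passing from ([rho], [e]) to ([rho - 1/4], [e']) *)

Section Step.
Variables (R : realFieldType) (d m n : nat).
Variables (v : 'I_n -> 'rV[R]_d) (g k : nat).
Hypotheses (g_gt0 : (0 < g)%N) (k_gt1 : (1 < k)%N).
Hypothesis v_le1 : forall j, dot (v j) (v j) <= 1.
Variables (rho e e' : R).
Hypotheses (rho_le : rho <= g%:R ^+ 2) (e'_le : e' <= 1 / 4).
Hypothesis e'_ge : 2 * e + 2 * g%:R / k%:R <= e'.

Implicit Types (u : 'I_m -> 'rV[R]_d) (A : 'M[int]_(m, n)) (U E : {set 'I_m}).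

Let gk_ge0 : 0 <= 2 * g%:R / k%:R :> R.
Proof. by rewrite divr_ge0 // mulr_ge0. Qed.

(** The condition inside [almost_const], named so that [c] can be chosen as a function of cluster
    and column. *)
Definition majority A E j (c : int) :=
  (k * #|[set i in E | A i j != c]| <= #|E|)%N.

Lemma majority_attained A E j c : (0 < #|E|)%N -> majority A E j c ->
  exists2 i, i \in E & A i j = c.
Proof.
move=> E0 Ec; suff /exists_inP[i iE /eqP Ai] : [exists i in E, A i j == c].
  by exists i.
apply: contraT => /exists_inPn no.
suff EE : [set i in E | A i j != c] = E.
  by move: Ec; rewrite /majority EE leqNgt (ltn_Pmull k_gt1 E0).
by apply/setP => i; rewrite inE; case: (boolP (i \in E)) => //= /no.
Qed.

Lemma majority_card A E j c : majority A E j c ->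
  (#|E| <= 2 * #|[set i in E | A i j == c]|)%N.
Proof.
rewrite /majority => Ec.
have : (#|E| <= #|[set i in E | A i j == c]| + #|[set i in E | A i j != c]|)%N.
  apply: leq_trans (leq_card_setU _ _); apply: subset_leq_card.
  by apply/subsetP => i iE; rewrite !inE iE /= orbN.
have : (2 * #|[set i in E | A i j != c]| <= k * #|[set i in E | A i j != c]|)%N.
  by rewrite leq_mul2r k_gt1 orbT.
lia.
Qed.

(** Averaging over [E], each row errs by at most [e], and the exceptional rows, a proportion at most
    [1/k], add at most [2g] each. *)
Lemma dot_mean_majority u A E j c : (0 < #|E|)%N -> majority A E j c ->
  (forall i, i \in E -> dot (u i) (u i) <= rho) ->
  (forall i j, i \in E -> `|dot (u i) (v j) - (A i j)%:~R| <= e) -> e <= 1 / 4 ->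
  `|dot (mean u E) (v j) - c%:~R| <= e + 2 * g%:R / k%:R.
Proof.
move=> E0 Ec ub uvA e4.
have E0R : 0 < #|E|%:R :> R by rewrite ltr0n.
have Ag i : i \in E -> (`|A i j| <= g)%N.
  move=> iE; apply: (approx_entry_le v_le1 e4 _ (uvA i j iE)).
  exact: le_trans (ub i iE) rho_le.
have cg : (`|c| <= g)%N by have [i /Ag + <-] := majority_attained E0 Ec.
have -> : dot (mean u E) (v j) - c%:~R =
    #|E|%:R^-1 * \sum_(i in E) (dot (u i) (v j) - c%:~R).
  rewrite sumrB sumr_const -(mulr_natl c%:~R) mulrBr mulrA mulVf ?gt_eqF // mul1r.
  by rewrite /mean dotZl dot_suml.
rewrite normrM ger0_norm ?invr_ge0 // ler_pdivrMl //.
apply: le_trans (ler_norm_sum _ _ _) _.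
have bound i : i \in E -> `|dot (u i) (v j) - c%:~R| <=
    e + 2 * g%:R * (A i j != c)%:R.
  move=> iE; have [<-|ne] := eqVneq; first by rewrite mulr0 addr0 uvA.
  have -> : dot (u i) (v j) - c%:~R =
    (dot (u i) (v j) - (A i j)%:~R) + (A i j - c)%:~R by rewrite intrB; ring.
  rewrite mulr1; apply: le_trans (ler_normD _ _) _; apply: lerD; first exact: uvA.
  rewrite -intr_norm -[2 * _]natrM -mulrz_nat ler_int.
  have := Ag i iE; lia.
apply: le_trans (ler_sum _ bound) _.
rewrite big_split /= sumr_const -mulr_sumr -natr_sum.
have -> : (\sum_(i in E) (A i j != c))%N = #|[set i in E | A i j != c]|.
  rewrite -sum1_card big_mkcond [RHS]big_mkcond; apply: eq_bigr => i _.
  by rewrite inE; case: (i \in E) => //; case: (A i j != c).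
rewrite mulrDr -[e *+ _]mulr_natl lerD2l.
have kR : 0 < k%:R :> R by rewrite ltr0n; lia.
rewrite mulrA ler_pdivlMr // mulrC mulrCA [leRHS]mulrC ler_wpM2l ?mulr_ge0 //.
by rewrite -natrM ler_nat.
Qed.

(** Greedy extraction: as long as some column has [D] nonzero rows left, take an almost constant set
    among those rows and remove it. Its rows thus share a column where none of them vanishes. *)
Lemma one_scale (D : nat) u A U : (0 < D)%N -> e <= 1 / 4 ->
  (forall i, i \in U -> row_ok v rho e u A i) ->
  exists P : {set {set 'I_m}}, [/\ trivIset P,
    forall E, E \in P -> [/\ (0 < #|E|)%N, E \subset U, almost_const k A E,
      (D <= (2 * k) ^ (64 * g ^ 2 + 1) * #|E|)%N
      & exists j, forall i, i \in E -> A i j != 0]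
    & forall j, (#|nbr A (U :\: cover P) j| < D)%N].
Proof.
(* The induction is on a bound [s] for [#|U|], which drops because each removed cluster is
   nonempty. *)
move=> D0 e4; move: {2}#|U| (leqnn #|U|) => s.
elim: s U => [|s IH] U Us Uok.
  exists set0; split=> [|E|j]; rewrite ?inE //.
    by apply/trivIsetP => E E'; rewrite inE.
  apply: leq_ltn_trans D0; apply: leq_trans Us; apply: subset_leq_card.
  by apply/subsetP => i; rewrite !inE => /andP[/andP[]].
have [[j Dj]|/forallNP noj] := pselect (exists j, (D <= #|nbr A U j|)%N); last first.
  exists set0; split=> [|E|j]; rewrite ?inE //.
    by apply/trivIsetP => E E'; rewrite inE.
  rewrite ltnNge; apply/negP; rewrite /cover big_set0 setD0; exact: noj.
have ok i : i \in nbr A U j ->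
    dot (u i) (u i) <= rho /\ forall j, `|dot (u i) (v j) - (A i j)%:~R| <= e.
  rewrite inE => /andP[iU Aij]; case: (Uok i iU) => // A0.
  by rewrite A0 eqxx in Aij.
have [|||E [EN Ec NE]] :=
    @almost_const_subset R d m n u v A g k v_le1 g_gt0 (ltnW k_gt1) (nbr A U j).
- exact: leq_trans Dj.
- by move=> i /ok[h _]; exact: le_trans h rho_le.
- by move=> i j' /ok[_ h]; exact: le_trans (h j') e4.
have E0 : (0 < #|E|)%N.
  by rewrite lt0n; apply/eqP => z; move: NE; rewrite z muln0; lia.
have EU : E \subset U.
  by apply: subset_trans EN _; apply/subsetP => i; rewrite inE => /andP[].
have [||P [tP PE Pdeg]] := IH (U :\: E).
- have := cardsID E U; rewrite (setIidPr EU); lia.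
- by move=> i /setDP[iU _]; exact: Uok.
have dE : {in P, forall F : {set 'I_m}, [disjoint E & F]}.
  move=> F /PE[_ FU _ _ _]; rewrite -setI_eq0; apply/eqP/setP => i.
  rewrite !inE; apply/negP => /andP[iE /(subsetP FU)].
  by rewrite !inE iE.
have P0 : set0 \notin P by apply/negP => /PE[]; rewrite cards0.
have [tP' _] := trivIsetU1 dE tP P0.
exists (E |: P); split=> // [F|j'].
  rewrite !inE => /predU1P[->|/PE[F0 FU Fc FD Fj]].
    split=> //; first exact: leq_trans Dj NE.
    by exists j => i /(subsetP EN); rewrite inE => /andP[].
  by split=> //; apply: subset_trans FU (subsetDl _ _).
have -> : U :\: cover (E |: P) = (U :\: E) :\: cover P.
  by rewrite setDDl /cover bigcup_setU big_set1.
exact: Pdeg.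
Qed.

(** Double counting: a cluster with nonzero majority in column [j] has at least half of its rows, so
    at least [D / (2 Delta)], in the neighbourhood of [j]; the clusters are disjoint and the
    neighbourhood has at most [2 D] rows. *)
Lemma cluster_degree (D Delta : nat) A U (P : {set {set 'I_m}})
    (c : {set 'I_m} -> 'I_n -> int) j : (0 < D)%N -> trivIset P ->
  (forall E, E \in P -> [/\ E \subset U, (D <= Delta * #|E|)%N & majority A E j (c E j)]) ->
  (#|nbr A U j| <= 2 * D)%N ->
  (#|[set E in P | c E j != 0%Z]| <= 4 * Delta)%N.
Proof.
move=> D0 tP PE deg; rewrite -(leq_pmul2r D0).
have : (\sum_(E in P) #|[set i in E | i \in nbr A U j]| <= #|nbr A U j|)%N.
  under eq_bigr => E _.
    rewrite -sum1_card (eq_bigl (fun i => (i \in E) && (i \in nbr A U j))); last first.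
      by move=> i; rewrite inE.
    rewrite big_mkcondr; over.
  rewrite /= -(big_trivIset _ (E := fun i => if i \in nbr A U j then 1 else 0)%N tP) /=.
  rewrite -big_mkcondr /= sum1_card; apply: subset_leq_card.
  by apply/subsetP => i /andP[].
move=> le_nbr; apply: (@leq_trans (2 * Delta * #|nbr A U j|)); last first.
  by apply: leq_trans (leq_mul (leqnn _) deg) _; rewrite mulnACA mulnA.
apply: leq_trans (leq_mul (leqnn _) le_nbr); rewrite -sum_nat_const big_distrr /=.
rewrite [leqLHS](eq_bigl (fun E => (E \in P) && (c E j != 0%Z))); last first.
  by move=> E; rewrite inE.
rewrite big_mkcondr /=; apply: leq_sum => E EP; case: ifP => // cE.
have [EU DE maj] := PE E EP; apply: leq_trans DE _.
rewrite (mulnC 2) -mulnA leq_mul2l; apply/orP; right.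
apply: leq_trans (majority_card maj) _; rewrite leq_mul2l /=.
apply: subset_leq_card; apply/subsetP => i; rewrite !inE => /andP[iE /eqP ->].
by rewrite iE (subsetP EU) //= cE.
Qed.

(* All the rows of a cluster meet a common column, so its mean w has |w|^2 >= 1/2;
   replacing u by u - w saves 1/4 of the squared norm on a 1/(4 g^2) fraction of
   the cluster. *)
Lemma cluster_step u A (P : {set {set 'I_m}}) (c : {set 'I_m} -> 'I_n -> int) :
  trivIset P ->
  (forall E, E \in P -> [/\ (0 < #|E|)%N,
     (forall j, majority A E j (c E j)), exists j, forall i, i \in E -> A i j != 0
     & forall i, i \in E -> row_ok v rho e u A i]) ->
  exists (X : {set 'I_m}) u', [/\ X \subset cover P,
    (#|cover P| <= 4 * g ^ 2 * #|X|)%N,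
    forall E j, E \in P -> (`|c E j| <= g)%N
    & forall i, i \in X -> row_ok v (rho - 1 / 4) e' u' (A - cluster_mx P c) i].
Proof.
move=> tP PE.
have ok E i : E \in P -> i \in E ->
    dot (u i) (u i) <= rho /\ forall j, `|dot (u i) (v j) - (A i j)%:~R| <= e.
  move=> EP iE; have [_ _ [j Aj] /(_ i iE)[A0|//]] := PE E EP.
  by have := Aj i iE; rewrite A0 eqxx.
(* [e] is nonnegative because it bounds an absolute value at a row and a column of the cluster. *)
have e4 E : E \in P -> 0 <= e /\ e + 2 * g%:R / k%:R <= 1 / 4.
  move=> EP; have [/card_gt0P[i iE] _ [j _] _] := PE E EP.
  have [_ /(_ j) h] := ok E i EP iE; have := le_trans (normr_ge0 _) h.
  by move=> e0; split=> //; move: gk_ge0 e'_ge e'_le; move: (2 * g%:R / k%:R) => x; lra.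
have meanP E j : E \in P ->
    `|dot (mean u E) (v j) - (c E j)%:~R| <= e + 2 * g%:R / k%:R.
  move=> EP; have [E0 maj _ _] := PE E EP; have [e0 e4'] := e4 E EP.
  apply: (dot_mean_majority E0 (maj j)) => [i iE|i j' iE|].
  - by case: (ok E i EP iE).
  - by case: (ok E i EP iE).
  - by move: gk_ge0; lra.
pose near E := [set i in E | (dot (u i - mean u E) (u i - mean u E) <= rho - 1 / 4)%R].
exists (\bigcup_(E in P) near E), (fun i => u i - mean u (pblock P i)); split.
- by apply/bigcupsP => E EP; apply: subset_trans (bigcup_sup _ EP);
    apply/subsetP => i; rewrite inE => /andP[].
- have nearE : \bigcup_(E in P) near E = [set i in cover P | i \in near (pblock P i)].
    apply/setP => i; rewrite [RHS]inE; apply/bigcupP/andP => [[E EP]|[iP ib]].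
      move=> iE; have iE' : i \in E by move: iE; rewrite inE => /andP[].
      by rewrite (def_pblock tP EP iE'); split=> //; apply/bigcupP; exists E.
    by exists (pblock P i); rewrite ?pblock_mem.
  rewrite nearE -[leqLHS]sum1_card -[#|[set _ in _ | _]|]sum1_card.
  rewrite [X in (_ <= _ * X)%N](eq_bigl (fun i => (i \in cover P) && (i \in near (pblock P i)))); last first.
    by move=> i; rewrite inE.
  rewrite big_mkcondr /= !(big_trivIset P tP) /= big_distrr /=; apply: leq_sum => E EP.
  rewrite [X in (_ <= _ * X)%N](eq_bigr (fun i => if i \in near E then 1 else 0)%N); last first.
    by move=> i iE; rewrite (def_pblock tP EP iE).
  rewrite -big_mkcondr /= !sum1_card.
  have [E0 maj [j Aj] _] := PE E EP; have [e0 e4'] := e4 E EP.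
  have : (#|E| <= 4 * g ^ 2 * #|near E|)%N.
    apply: card_near_mean => // [i iE|]; first by case: (ok E i EP iE).
    (* On the common column the majority value is a nonzero integer, so the mean pairs with [v j] to
       at least 3/4 in absolute value, and Cauchy-Schwarz gives [9/16 >= 1/2]. *)
    have [i iE cE] := majority_attained E0 (maj j).
    have c0 : (1 <= `|c E j|)%N by rewrite -cE absz_gt0 Aj.
    have c1 : 1 <= `|(c E j)%:~R| :> R.
      by rewrite -intr_norm -[1 : R]mulr1z ler_int; lia.
    have := meanP E j EP; have := dot_CauchySchwarz (mean u E) (v j).
    have := v_le1 j; have := dot_ge0 (mean u E).
    have := lerB_dist (c E j)%:~R (dot (mean u E) (v j)); rewrite distrC.
    rewrite -[dot _ (v j) ^+ 2]real_normK ?num_real //.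
    move: (`|dot (mean u E) (v j)|) => x; set W := dot (mean u E) (mean u E).
    set V := dot (v j) (v j) => *.
    have : W * V <= W * 1 by rewrite ler_wpM2l.
    have : 3 / 4 <= x by lra.
    nra.
  move/leq_trans; apply; rewrite leq_mul2l; apply/orP; right.
  apply: subset_leq_card; apply/subsetP => i iN; apply/andP; split=> //.
  by move: iN; rewrite inE => /andP[].
- move=> E j EP; have [E0 maj _ _] := PE E EP; have [e0 e4'] := e4 E EP.
  have [i iE <-] := majority_attained E0 (maj j).
  have [ub uvA] := ok E i EP iE.
  apply: (approx_entry_le v_le1 _ _ (uvA j)); last exact: le_trans ub rho_le.
  by move: gk_ge0; lra.
move=> i /bigcupP[E EP]; rewrite inE => /andP[iE near_i]; right.
rewrite (def_pblock tP EP iE); split=> // j.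
rewrite entryB (cluster_mxE _ _ tP EP iE) intrB dotBl.
have [_ uvA] := ok E i EP iE.
have -> : dot (u i) (v j) - dot (mean u E) (v j) - ((A i j)%:~R - (c E j)%:~R) =
  (dot (u i) (v j) - (A i j)%:~R) - (dot (mean u E) (v j) - (c E j)%:~R) by ring.
apply: le_trans (ler_normB _ _) _.
have := uvA j; have := meanP E j EP; move: e'_ge; lra.
Qed.

(** Induction on the dyadic scale: clusters are extracted at threshold [2 ^ l], and the other rows
    then have neighbourhoods smaller than that. The two row sets are disjoint, so vectors, matrices
    and cardinalities combine. *)
Lemma scales_step (l : nat) u A U : e <= 1 / 4 ->
  (forall i, i \in U -> row_ok v rho e u A i) ->
  (forall j, #|nbr A U j| < 2 ^ l)%N ->
  exists (X : {set 'I_m}) u' (C : 'M[int]_(m, n)), [/\ X \subset U,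
    (#|U| <= 4 * g ^ 2 * #|X|)%N,
    block_decomp C (l * (4 * (2 * k) ^ (64 * g ^ 2 + 1) * (g * 2))),
    (forall i j, i \notin U -> C i j = 0)
    & forall i, i \in X -> row_ok v (rho - 1 / 4) e' u' (A - C) i].
Proof.
move=> e4; elim: l U => [|l IH] U Uok deg.
  exists U, u, 0; split=> //.
  - by rewrite leq_pmull //; lia.
  - exact: block_decomp0.
  - by move=> i j; rewrite mxE.
  (* At scale 0 all neighbourhoods are empty: the matrix vanishes on [U], the exempt case of
     [row_ok]. *)
  move=> i iU; left=> j; rewrite subr0; apply/eqP; apply: contraT => Aij.
  have := deg j; rewrite ltnS leqn0 cards_eq0 => /eqP/setP/(_ i).
  by rewrite !inE iU Aij.
have [P [tP PE Pdeg]] := one_scale (expn_gt0 2 l : (0 < 2 ^ l)%N) e4 Uok.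
have Pex Ej : exists c, Ej.1 \in P -> majority A Ej.1 Ej.2 c.
  case: Ej => E j /=; have [EP|EP] := boolP (E \in P); last by exists 0.
  by have [_ _ /(_ j)[c Ec] _ _] := PE E EP; exists c.
have [c0 c0P] := choice Pex; pose c E j := c0 (E, j).
have maj E j : E \in P -> majority A E j (c E j) by exact: (c0P (E, j)).
have PU : cover P \subset U by apply/bigcupsP => E /PE[].
have [|X1 [u1 [X1P cX1 cg ok1]]] := @cluster_step u A P c tP.
  move=> E EP; have [E0 EU _ _ Ej] := PE E EP; split=> // [j|i iE].
    exact: maj.
  by apply: Uok; exact: (subsetP EU).
have [||X2 [u2 [C2 [X2U cX2 dC2 C2out ok2]]]] := IH (U :\: cover P).
- by move=> i /setDP[iU _]; exact: Uok.
- exact: Pdeg.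
exists (X1 :|: X2), (fun i => if i \in cover P then u1 i else u2 i),
  (cluster_mx P c + C2); split.
- by rewrite subUset (subset_trans X1P PU) (subset_trans X2U (subsetDl _ _)).
- have dX : [disjoint X1 & X2].
    rewrite -setI_eq0; apply/eqP/setP => i; rewrite !inE.
    apply/negP => /andP[/(subsetP X1P) iP /(subsetP X2U)].
    by rewrite !inE iP.
  rewrite -(cardsID (cover P) U) (setIidPr PU).
  have := leq_card_setU X1 X2; rewrite dX => -[_ /eqP->].
  by rewrite mulnDr leq_add.
- rewrite mulSn; apply: block_decompD => //; apply: block_decomp_cluster => // j.
  (* Neighbourhoods in [U] are below [2 ^ l.+1], twice the extraction threshold. *)
  apply: (@cluster_degree (2 ^ l) _ A U) => // [|E EP|].
  - by rewrite expn_gt0.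
  - by have [_ EU _ DE _] := PE E EP; split=> //; exact: maj.
  - by have := deg j; rewrite expnS; exact: ltnW.
- move=> i j iU; rewrite mxE C2out ?addr0; last by rewrite inE (negPf iU) andbF.
  by apply: cluster_mx_out; apply: contra iU => /(subsetP PU).
move=> i /setUP[iX|iX].
  have iP := subsetP X1P i iX.
  have C20 j : C2 i j = 0 by apply: C2out; rewrite inE iP.
  case: (ok1 i iX) => [A0|[ub uvA]]; [left=> j|right].
    by rewrite -(A0 j) !entryB entryD C20 addr0.
  rewrite iP; split=> // j; have := uvA j.
  by rewrite !entryB entryD C20 addr0.
have /setDP[iU /negPf iP] := subsetP X2U i iX.
have C10 j : cluster_mx P c i j = 0 by apply: cluster_mx_out; rewrite iP.
case: (ok2 i iX) => [A0|[ub uvA]]; [left=> j|right].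
  by rewrite -(A0 j) !entryB entryD C10 add0r.
rewrite iP; split=> // j; have := uvA j.
by rewrite !entryB entryD C10 add0r.
Qed.

End Step.

(** * Covering all rows *)

Section Cover.
Variables (R : realFieldType) (d m n : nat).
Variables (u : 'I_m -> 'rV[R]_d) (v : 'I_n -> 'rV[R]_d) (A : 'M[int]_(m, n)).
Variables (g l : nat).
Hypothesis g_gt0 : (0 < g)%N.
Hypothesis m_lt : (m < 2 ^ l)%N.
Hypothesis u_le : forall i, dot (u i) (u i) <= g%:R ^+ 2.
Hypothesis v_le1 : forall j, dot (v j) (v j) <= 1.
Hypothesis AE : forall i j, (A i j)%:~R = dot (u i) (v j).

(** The number of rounds: a squared norm of at most [g^2] drops by 1/4 each time. *)
Let T := (4 * g ^ 2)%N.
(** Chosen so that the error [2g/k] added in each round equals [1 / (4 2^T)]. *)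
Let k := (8 * g * 2 ^ T)%N.
Let K := (4 * (2 * k) ^ (64 * g ^ 2 + 1) * (g * 2))%N.

(** The error bound solves the recurrence [e' = 2 e + 1 / (4 2^T)] from [e = 0], and stays below 1/4
    for all [T] rounds. *)
Lemma iterated_step (U : {set 'I_m}) s : (s <= T)%N ->
  exists (X : {set 'I_m}) u' (B : 'M[int]_(m, n)), [/\ X \subset U,
    (#|U| <= (4 * g ^ 2) ^ s * #|X|)%N, block_decomp (A - B) (s * (l * K))
    & forall i, i \in X -> row_ok v (g%:R ^+ 2 - s%:R / 4)
        ((2 ^+ s - 1) / (4 * 2 ^+ T)) u' B i].
Proof.
have p2 t : 0 < 2 ^+ t :> R by rewrite exprn_gt0.
have eT s' : (s' <= T)%N -> (2 ^+ s' - 1) / (4 * 2 ^+ T) <= 1 / 4 :> R.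
  move=> sT; rewrite ler_pdivrMr ?mulr_gt0 //.
  have : 2 ^+ s' <= 2 ^+ T :> R by rewrite ler_weXn2l // ler1n.
  by lra.
elim: s => [_|s IH sT].
  exists U, u, A; split; rewrite ?expn0 ?mul1n //.
    by rewrite subrr; exact: block_decomp0.
  move=> i _; right; rewrite mul0r subr0; split=> // j.
  by rewrite AE subrr normr0 expr0 subrr mul0r.
have [X [u1 [B [XU cX dB okX]]]] := IH (ltnW sT).
have k_gt1 : (1 < k)%N.
  have : (0 < 2 ^ T)%N by rewrite expn_gt0.
  by rewrite /k; move: (2 ^ T)%N => p; nia.
have [||||||X' [u' [C [X'X cX' dC Cout ok']]]] := @scales_step R d m n v g k
  g_gt0 k_gt1 v_le1 (g%:R ^+ 2 - s%:R / 4) ((2 ^+ s - 1) / (4 * 2 ^+ T))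
  ((2 ^+ s.+1 - 1) / (4 * 2 ^+ T)) _ _ _ l u1 B X.
- by rewrite lerBlDr lerDl divr_ge0.
- exact: eT.
- rewrite /k !natrM natrX exprS.
  have gR : g%:R != 0 :> R by rewrite pnatr_eq0 -lt0n.
  rewrite le_eqVlt; apply/orP; left; apply/eqP.
  by have := lt0r_neq0 (p2 T); move: (2 ^+ T) => z z0; field; rewrite gR z0.
- exact: eT (ltnW sT).
- exact: okX.
- move=> j; apply: leq_ltn_trans m_lt; rewrite -[leqRHS]card_ord; exact: max_card.
exists X', u', (B - C); split.
- exact: subset_trans X'X XU.
- apply: leq_trans cX _; by rewrite [(_ ^ s.+1)%N]expnSr -mulnA leq_mul2l cX' orbT.
- by rewrite mulSn addnC (_ : A - (B - C) = (A - B) + C);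
    [apply: block_decompD | rewrite opprB addrA addrAC].
- move=> i /ok'; congr (row_ok _ _ _ _ _ _).
  by rewrite -[s.+1%:R]natr1; lra.
Qed.

(** After [T] rounds the norm bound is 0, so the remaining integer entries are smaller than 1 in
    absolute value and vanish on [X]. *)
Lemma dense_rows (U : {set 'I_m}) : exists X : {set 'I_m}, [/\ X \subset U,
  (#|U| <= (4 * g ^ 2) ^ T * #|X|)%N
  & block_decomp (row_restrict X A) (T * (l * K))].
Proof.
have [X [u' [B [XU cX dB okX]]]] := iterated_step U (leqnn T).
exists X; split=> //.
have -> : row_restrict X A = row_restrict X (A - B); last first.
  exact: block_decomp_row_restrict.
apply/matrixP => i j; rewrite mxE [RHS]mxE; case: ifP => // iX.
rewrite entryB; suff -> : B i j = 0 by rewrite subr0.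
case: (okX i iX) => [->//|[ub /(_ j) uvB]].
have u0 : dot (u' i) (u' i) <= 0.
  by apply: le_trans ub _; rewrite /T natrM natrX; lra.
have uv0 : dot (u' i) (v j) = 0.
  apply/eqP; rewrite -sqrf_eq0 eq_le sqr_ge0 andbT.
  apply: le_trans (dot_CauchySchwarz _ _) _.
  by rewrite mulr_le0_ge0 // dot_ge0.
have : `|(B i j)%:~R| < 1 :> R.
  move: uvB; rewrite uv0 sub0r normrN => /le_lt_trans; apply.
  have p : 0 < 2 ^+ T :> R by rewrite exprn_gt0.
  by rewrite ltr_pdivrMr ?mulr_gt0 // mul1r; lra.
rewrite -intr_norm -[1 : R](mulr1z) ltr_int; lia.
Qed.

(** Each round applies [dense_rows] to the uncovered rows and shrinks their number by the factor
    [1 - 1/H], written without division. *)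
Lemma covered_rows t : let H := ((4 * g ^ 2) ^ T)%N in
  exists Y : {set 'I_m}, (#|~: Y| * H ^ t <= H.-1 ^ t * m)%N /\
    block_decomp (row_restrict Y A) (t * (T * (l * K))).
Proof.
move=> H; elim: t => [|t [Y [cY dY]]].
  exists set0; rewrite !expn0 muln1 mul1n setC0 cardsT card_ord; split=> //.
  rewrite (_ : row_restrict _ _ = 0); first exact: block_decomp0.
  by apply/matrixP => i j; rewrite !mxE inE.
have H_gt0 : (0 < H)%N by rewrite expn_gt0 muln_gt0 expn_gt0 g_gt0.
have [X [XY cX dX]] := dense_rows (~: Y).
exists (Y :|: X); split.
  have cXY : #|~: Y| = (#|~: (Y :|: X)| + #|X|)%N.
    by rewrite -(cardsID X (~: Y)) (setIidPr XY) setCU -setDE addnC.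
  have step : (#|~: (Y :|: X)| * H <= #|~: Y| * H.-1)%N.
    by move: cX; rewrite -/H cXY; move: H_gt0; nia.
  rewrite !expnSr; apply: (@leq_trans (#|~: Y| * H.-1 * H ^ t)%N).
    by rewrite mulnA mulnAC leq_mul2r step orbT.
  by rewrite mulnAC [leqRHS]mulnAC leq_mul2r cY orbT.
have -> : row_restrict (Y :|: X) A = row_restrict X A + row_restrict Y A.
  apply/matrixP => i j; rewrite !mxE inE.
  have [iX|] := boolP (i \in X); last by rewrite orbF add0r.
  by have := subsetP XY i iX; rewrite inE => /negPf ->; rewrite addr0.
by rewrite mulSn; apply: block_decompD.
Qed.

(** This is [(1 - 1/h)^h <= 1/2], a consequence of the Bernoulli inequality. *)
Lemma double_expn_pred h : (0 < h)%N -> (2 * h.-1 ^ h <= h ^ h)%N.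
Proof.
have bernoulli h' t : (h' ^ t.+1 + t.+1 * h' ^ t <= h'.+1 ^ t.+1)%N.
  elim: t => [|t IH]; first by rewrite !expn1 expn0; lia.
  apply: (@leq_trans (h'.+1 * (h' ^ t.+1 + t.+1 * h' ^ t))).
    by rewrite !(expnS h') mulnDr; nia.
  by rewrite [leqRHS]expnS leq_mul2l IH orbT.
case: h => // h _; apply: leq_trans (bernoulli h h); rewrite /= expnS; nia.
Qed.

Lemma block_decomp_factor :
  block_decomp A ((4 * g ^ 2) ^ T * l * (T * (l * K))).
Proof.
set H := ((4 * g ^ 2) ^ T)%N.
(* After [H l] rounds fewer than [m / 2^l + 1] rows could remain, and [m < 2^l] leaves none. *)
have [Y [cY dY]] := covered_rows (H * l); rewrite -/H in cY dY.
have H_gt0 : (0 < H)%N by rewrite expn_gt0 muln_gt0 expn_gt0 g_gt0.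
suff Y0 : ~: Y = set0.
  have -> : A = row_restrict Y A; last exact: dY.
  apply/matrixP => i j; rewrite mxE ifT //.
  by have /setP/(_ i) := Y0; rewrite !inE => /negbFE.
apply/eqP; rewrite -cards_eq0 -leqn0 leqNgt; apply/negP => Ypos.
have HH : (2 ^ l * H.-1 ^ (H * l) <= H ^ (H * l))%N.
  rewrite !expnM -expnMn; case: l => [|l'] //.
  by rewrite leq_exp2r // double_expn_pred.
have Q_gt0 : (0 < H ^ (H * l))%N by rewrite expn_gt0 H_gt0.
have : (m * H.-1 ^ (H * l) <= (2 ^ l).-1 * H.-1 ^ (H * l))%N.
  by rewrite leq_mul2r; apply/orP; right; lia.
have : (1 * H ^ (H * l) <= #|~: Y| * H ^ (H * l))%N by rewrite leq_mul2r Ypos orbT.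
have : (0 < 2 ^ l)%N by rewrite expn_gt0.
move: cY HH Q_gt0; move: (H.-1 ^ (H * l))%N (H ^ (H * l))%N (2 ^ l)%N => P Q L.
nia.
Qed.
End Cover.

(** * The factorization norm *)

(** The four factors have exponents at most [16 g^4], [4 g], [585 g^4] and [4 g], with total at most
    [609 g^4], hence at most [609 g^7]. *)
Lemma factor_bound_le (g l : nat) : (0 < g)%N ->
  ((4 * g ^ 2) ^ (4 * g ^ 2) * l * (4 * g ^ 2 *
     (l * (4 * (2 * (8 * g * 2 ^ (4 * g ^ 2))) ^ (64 * g ^ 2 + 1) * (g * 2))))
   <= 2 ^ (609 * g ^ 7) * l ^ 2)%N.
Proof.
move=> g0.
have gg : (g <= 2 ^ g)%N by apply: ltnW; exact: ltn_expl.
have T_le : (4 * g ^ 2 <= 2 ^ (4 * g))%N.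
  apply: (@leq_trans (2 ^ (2 + 2 * g))); last by rewrite leq_exp2l //; lia.
  by rewrite expnD (mulnC 2%N g) expnM; apply: leq_mul; rewrite ?leq_exp2r.
have H_le : ((4 * g ^ 2) ^ (4 * g ^ 2) <= 2 ^ (16 * g ^ 4))%N.
  apply: (@leq_trans ((2 ^ (4 * g)) ^ (4 * g ^ 2))).
    by rewrite leq_exp2r // muln_gt0 expn_gt0 g0.
  by rewrite -expnM leq_exp2l // mulnACA leq_mul2l -expnS leq_pexp2l.
have k_le : (2 * (8 * g * 2 ^ (4 * g ^ 2)) <= 2 ^ (9 * g ^ 2))%N.
  apply: (@leq_trans (2 ^ (4 + g + 4 * g ^ 2))); last by rewrite leq_exp2l //; nia.
  by rewrite (expnD _ (4 + g)) (expnD _ 4) !mulnA; apply: leq_mul; rewrite ?leq_mul.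
have D_le : ((2 * (8 * g * 2 ^ (4 * g ^ 2))) ^ (64 * g ^ 2 + 1)
    <= 2 ^ (585 * g ^ 4))%N.
  apply: (@leq_trans ((2 ^ (9 * g ^ 2)) ^ (64 * g ^ 2 + 1))).
    by rewrite leq_exp2r // addn_gt0 orbT.
  rewrite -expnM leq_exp2l //.
  apply: (@leq_trans (9 * g ^ 2 * (65 * g ^ 2))).
    by rewrite leq_mul2l; apply/orP; right; nia.
  by rewrite mulnACA -expnD.
have c_le : (4 * (g * 2) <= 2 ^ (4 * g))%N.
  apply: (@leq_trans (2 ^ (3 + g))); last by rewrite leq_exp2l //; lia.
  by rewrite expnD mulnCA mulnC; apply: leq_mul.
have exp_le : (16 * g ^ 4 + 4 * g + 585 * g ^ 4 + 4 * g <= 609 * g ^ 7)%N.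
  have g4 : (g <= g ^ 4)%N by rewrite -{1}(expn1 g) leq_pexp2l.
  have g7 : (g ^ 4 <= g ^ 7)%N by rewrite leq_pexp2l.
  by clear - g4 g7; move: (g ^ 4)%N (g ^ 7)%N g4 g7 => x y; lia.
have all_le := leq_mul (leq_mul (leq_mul H_le T_le) D_le) c_le.
rewrite -!expnD in all_le.
have := leq_trans all_le (leq_pexp2l (isT : 0 < 2)%N exp_le).
set T := (4 * g ^ 2)%N; move: (T ^ T)%N => H.
move: ((2 * _) ^ _)%N => D; move: (2 ^ (609 * _))%N => E le_E.
have -> : (H * l * (T * (l * (4 * D * (g * 2)))) = H * T * D * (4 * (g * 2)) * l ^ 2)%N.
  by rewrite expnS expn1; ring.
by rewrite leq_mul2r le_E orbT.
Qed.

Lemma row_norm_ge0 m d (U : 'M[RR]_(m, d)) : 0 <= row_norm U.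
Proof. by rewrite /row_norm bigmax_ge_id. Qed.

Lemma col_norm_ge0 d n (V : 'M[RR]_(d, n)) : 0 <= col_norm V.
Proof. by rewrite /col_norm bigmax_ge_id. Qed.

Lemma dot_row_le m d (U : 'M[RR]_(m, d)) i :
  dot (row i U) (row i U) <= row_norm U ^+ 2.
Proof.
have : Num.sqrt (\sum_(j < d) U i j ^+ 2) <= row_norm U.
  exact: (le_bigmax 0 (fun i => Num.sqrt (\sum_(j < d) U i j ^+ 2)) i).
rewrite -ler_sqr ?nnegrE ?sqrtr_ge0 ?row_norm_ge0 // sqr_sqrtr; last first.
  by apply: sumr_ge0 => j _; exact: sqr_ge0.
by apply: le_trans; rewrite /dot le_eqVlt; apply/orP; left; apply/eqP;
  apply: eq_bigr => j _; rewrite !mxE expr2.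
Qed.

Lemma dot_col_le d n (V : 'M[RR]_(d, n)) j :
  dot (col j V)^T (col j V)^T <= col_norm V ^+ 2.
Proof.
have : Num.sqrt (\sum_(i < d) V i j ^+ 2) <= col_norm V.
  exact: (le_bigmax 0 (fun j => Num.sqrt (\sum_(i < d) V i j ^+ 2)) j).
rewrite -ler_sqr ?nnegrE ?sqrtr_ge0 ?col_norm_ge0 // sqr_sqrtr; last first.
  by apply: sumr_ge0 => i _; exact: sqr_ge0.
by apply: le_trans; rewrite /dot le_eqVlt; apply/orP; left; apply/eqP;
  apply: eq_bigr => i _; rewrite !mxE expr2.
Qed.

(** The strict inequality yields a factorization with norm product below [c]. Moving the column norm
    [b] over to the rows normalises it; [A != 0] makes [b] nonzero. *)
Lemma gamma2_factorization m n (A : 'M[int]_(m, n)) (c : RR) : A != 0 ->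
  gamma2 (intmx_to_R A) < c ->
  exists (d : nat) (u : 'I_m -> 'rV[RR]_d) (v : 'I_n -> 'rV[RR]_d),
    [/\ 0 <= c, forall i j, (A i j)%:~R = dot (u i) (v j),
      forall i, dot (u i) (u i) <= c ^+ 2 & forall j, dot (v j) (v j) <= 1].
Proof.
move=> A0; rewrite /gamma2 => /inf_lt[].
  (* The trivial factorization through the identity shows that the infimum is over a nonempty
     set. *)
  exists (row_norm (intmx_to_R A) * col_norm (1%:M : 'M[RR]_n)).
  by exists n, (intmx_to_R A), 1%:M; rewrite mulmx1.
move=> _ [d [U [V [AUV ->]]]] UVc.
have a0 := row_norm_ge0 U; have b0 := col_norm_ge0 V.
set a := row_norm U in a0 UVc; set b := col_norm V in b0 UVc.
have c0 : 0 <= c by apply: le_trans (ltW UVc); exact: mulr_ge0.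
have entry i j : (A i j)%:~R = dot (row i U) (col j V)^T :> RR.
  have /matrixP/(_ i j) := AUV; rewrite !mxE => ->.
  by apply: eq_bigr => k _; rewrite !mxE.
have b_neq0 : b != 0.
  apply: contra A0 => /eqP b_0; apply/eqP/matrixP => i j; rewrite mxE.
  have := dot_CauchySchwarz (row i U) (col j V)^T; rewrite -entry.
  have := dot_col_le V j; rewrite -/b b_0 expr0n /= => Vj.
  have Vj0 : dot (col j V)^T (col j V)^T = 0.
    by apply/eqP; rewrite eq_le Vj dot_ge0.
  rewrite Vj0 mulr0 => A2; apply/eqP; rewrite -(intr_eq0 RR) -sqrf_eq0.
  by rewrite eq_le A2 sqr_ge0.
exists d, (fun i => b *: row i U), (fun j => b^-1 *: (col j V)^T); split=> //.
- move=> i j; rewrite entry dotZl [in RHS]dotC dotZl mulrA divff // mul1r.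
  exact: dotC.
- move=> i; rewrite dotZl dotC dotZl mulrA -expr2.
  apply: (@le_trans _ _ ((a * b) ^+ 2)); last first.
    by rewrite ler_sqr ?nnegrE ?mulr_ge0 // ltW.
  by rewrite exprMn mulrC ler_wpM2r ?sqr_ge0 // dot_row_le.
move=> j; rewrite dotZl dotC dotZl mulrA -expr2 exprVn mulrC.
rewrite ler_pdivrMr ?mul1r ?dot_col_le //.
by rewrite exprn_gt0 // lt_def b_neq0.
Qed.

(** If [gamma < 1], Cauchy-Schwarz makes every integer entry smaller than 1 in absolute value, so
    [A] is zero. *)
Lemma gamma2_ge1 m n (A : 'M[int]_(m, n)) (gamma : RR) : A != 0 ->
  gamma2 (intmx_to_R A) <= gamma -> 1 <= gamma.
Proof.
move=> A0 Ag; rewrite leNgt; apply/negP => g1.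
have [|d [u [v [c0 entry ub vb]]]] := @gamma2_factorization _ _ A ((gamma + 1) / 2) A0.
  by apply: le_lt_trans Ag _; lra.
case/negP: A0; apply/eqP/matrixP => i j; rewrite mxE.
have : (A i j)%:~R ^+ 2 < 1 :> RR.
  rewrite entry; apply: le_lt_trans (dot_CauchySchwarz _ _) _.
  have := ub i; have := vb j; have := dot_ge0 (u i); have := dot_ge0 (v j).
  move: c0 g1; move: (dot (u i) (u i)) (dot (v j) (v j)) => x y *.
  have : x * y <= x * 1 by rewrite ler_wpM2l.
  nra.
rewrite -rmorphXn -[1 in ltRHS](mulr1z) /= ltr_int; nia.
Qed.

(** When there are fewer columns than rows, the transpose is decomposed instead, with the factor [g]
    moved from the [u i] to the [v j]. *)
Lemma block_decomp_min m n (A : 'M[int]_(m, n)) d (u : 'I_m -> 'rV[RR]_d)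
    (v : 'I_n -> 'rV[RR]_d) (g : nat) :
  (0 < g)%N -> (forall i j, (A i j)%:~R = dot (u i) (v j)) ->
  (forall i, dot (u i) (u i) <= g%:R ^+ 2) -> (forall j, dot (v j) (v j) <= 1) ->
  block_decomp A (2 ^ (609 * g ^ 7) * (trunc_log 2 (minn m n)).+1 ^ 2).
Proof.
move=> g0 entry ub vb.
apply: block_decomp_leq (factor_bound_le (trunc_log 2 (minn m n)).+1 g0) _.
have [mn|nm] := leqP m n.
  by apply: block_decomp_factor ub vb entry => //; exact: trunc_log_ltn.
have gR : g%:R != 0 :> RR by rewrite pnatr_eq0 -lt0n.
rewrite -[A]trmxK; apply: block_decomp_trmx.
apply: (@block_decomp_factor _ d n m (fun j => g%:R *: v j) (fun i => g%:R^-1 *: u i)) => //.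
- exact: trunc_log_ltn.
- move=> j; rewrite dotZl dotC dotZl mulrA -expr2 -[leRHS]mulr1.
  by rewrite ler_wpM2l ?sqr_ge0.
- move=> i; rewrite dotZl dotC dotZl mulrA -expr2 exprVn mulrC.
  by rewrite ler_pdivrMr ?mul1r // exprn_gt0 // ltr0n.
move=> j i; rewrite mxE entry dotZl [in RHS]dotC dotZl mulrA divff // mul1r.
by [].
Qed.

(** With [q] the truncated logarithm, [q ln 2 <= ln k]; moreover [ln 2 >= 1/2], from
    [ln (1 + x) <= x] at [x = -1/2], and [q + 1 <= 2 q]. *)
Lemma trunc_log_le_ln (k : nat) : (2 <= k)%N ->
  ((trunc_log 2 k).+1%:R : RR) <= 4 * ln (k%:R : RR).
Proof.
move=> k2; have k0 : (0 < k)%N by exact: ltnW.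
have ln2 : 1 / 2 <= ln (2 : RR).
  have := @le_ln1Dx RR (- (1 / 2)); rewrite (_ : 1 + - (1 / 2) = 2^-1 :> RR); last by field.
  by rewrite lnV ?posrE //; lra.
have q1 : (1 <= trunc_log 2 k)%N by rewrite trunc_log_gt0.
have : ln ((2 : RR) ^+ trunc_log 2 k) <= ln k%:R.
  rewrite ler_ln ?posrE ?exprn_gt0 ?ltr0n //.
  by rewrite -natrX ler_nat trunc_logP.
rewrite lnXn // -(mulr_natl (ln 2)) -[(trunc_log 2 k).+1%:R]natr1.
have : 1 <= (trunc_log 2 k)%:R :> RR by rewrite ler1n.
move: ((trunc_log 2 k)%:R : RR) => q q_ge1 q_ln.
have : q * (1 / 2) <= q * ln 2 by rewrite ler_wpM2l //; lra.
by lra.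
Qed.

Theorem theorem1p3 :
  exists C : RR, 0 < C /\
    forall (m n : nat) (A : 'M[int]_(m, n)) (gamma : RR),
      gamma2 (intmx_to_R A) <= gamma ->
      (2 <= minn m n)%N ->
      ((block A)%:R : RR) <= (2 : RR) `^ (C * gamma ^+ 7) * (ln ((minn m n)%:R : RR)) ^+ 2.
Proof.
(* The first term comes from [g <= 3 gamma] in the exponent [609 g^7]; the 4 absorbs the factor
   [4^2 = 2^4] from comparing logarithms, as [gamma >= 1]. *)
pose C : RR := 609 * 3 ^+ 7 + 4.
exists C; split; first by rewrite addr_gt0 ?mulr_gt0 ?exprn_gt0.
move=> m n A gamma Ag mn2; have [->|A0] := eqVneq A 0.
  have := block_le (block_decomp0 m n 0); rewrite leqn0 => /eqP ->.
  by rewrite mulr_ge0 ?powR_ge0 ?sqr_ge0.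
have g1 := gamma2_ge1 A0 Ag.
(* This integer lies strictly above [gamma] and is at most [gamma + 2 <= 3 gamma]. *)
pose g := (Num.truncn gamma + 2)%N.
have /andP[tr_le tr_gt] := truncn_itv (le_trans ler01 g1).
have g_gt : gamma < g%:R.
  by apply: lt_trans tr_gt _; rewrite ltr_nat /g; lia.
have g_le : g%:R <= 3 * gamma by rewrite natrD; lra.
have [d [u [v [c0 entry ub vb]]]] := gamma2_factorization A0 (le_lt_trans Ag g_gt).
have g0 : (0 < g)%N by rewrite /g addn2.
have := block_le (block_decomp_min g0 entry ub vb).
rewrite -(ler_nat RR) => /le_trans; apply.
set k := minn m n; rewrite natrM !natrX.
have l4 : (trunc_log 2 k).+1%:R ^+ 2 <= 2 ^+ 4 * ln (k%:R : RR) ^+ 2.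
  have lnk0 : 0 <= ln (k%:R : RR) by rewrite ln_ge0 // ler1n; lia.
  have := lerXn2r 2 (ler0n RR _) (mulr_ge0 (ler0n RR 4) lnk0) (trunc_log_le_ln mn2).
  by rewrite exprMn (_ : 4 ^+ 2 = 2 ^+ 4) // -!natrX.
apply: le_trans (ler_wpM2l _ l4) _; first exact: exprn_ge0.
rewrite mulrA ler_wpM2r ?sqr_ge0 // -exprD -powR_mulrn // ler_powR //; first by rewrite ler1n.
rewrite (natrD _ (609 * _)%N) (natrM _ 609) (natrX _ g).
have -> : C * gamma ^+ 7 = 609 * (3 * gamma) ^+ 7 + 4 * gamma ^+ 7.
  by rewrite [LHS]mulrDl exprMn; congr (_ + _); symmetry; exact: mulrA.
have g7 : g%:R ^+ 7 <= (3 * gamma) ^+ 7 by rewrite lerXn2r ?nnegrE //; lra.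
have gamma7 : 1 <= gamma ^+ 7 by rewrite exprn_ege1.
have g7' : 609 * g%:R ^+ 7 <= 609 * (3 * gamma) ^+ 7 :> RR by rewrite ler_wpM2l.
have gamma7' : 4 <= 4 * gamma ^+ 7 :> RR by lra.
exact: lerD g7' gamma7'.
Qed.
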